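(* Let $c>0$ and let $\phi:\mathbb{R}\to\mathbb{R}$ be a continuous solitary wave with decay (that is, $\phi(x)\to 0$ as $|x|\to\infty$) solving the steady Degasperis-Procesi equation $$\frac{\phi(x)}{3}\,(2c-\phi(x)) = (K*\phi^2)(x),\qquad x\in\mathbb{R},\qquad K(x)=\tfrac12 e^{-|x|}.$$ Then the image of the map $x\mapsto e^{|x|}\phi(x)$, $x\in\mathbb{R}$, is a bounded, simply connected set in $[0,\infty)$.
   Context: $K(x)=\frac12 e^{-|x|}$ is the convolution kernel of the operator $L=(1-\partial_x^2)^{-1}$, i.e. $Lf=K*f$ with $(K*f)(x)=\int_{\mathbb{R}}K(x-y)f(y)\,\mathrm{d}y$. The constant $c>0$ is the wave speed. *)

(* Defs.v *)
From mathcomp Require Import all_boot all_order all_algebra.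
From mathcomp Require Import all_classical all_reals all_analysis.
Import Order.TTheory GRing.Theory Num.Theory.
Import numFieldNormedType.Exports.

Set Implicit Arguments.
Unset Strict Implicit.
Unset Printing Implicit Defensive.

Local Open Scope classical_set_scope.
Local Open Scope ring_scope.

Definition K {R : realType} (x : R) : R := 2^-1 * expR (- `|x|).

(* [Rintegral] is the real part of the Lebesgue integral. For f bounded and
   continuous, y |-> K (x - y) * f y is integrable, so no junk value occurs. *)
Definition convolution {R : realType} (k f : R -> R) (x : R) : R :=
  \int[@lebesgue_measure R]_(y in setT) (k (x - y) * f y).

Definition steady_DP {R : realType} (c : R) (phi : R -> R) : Prop :=
  forall x, phi x / 3 * (2 * c - phi x) =
            convolution K (fun y => phi y ^+ 2) x.

Definition decays {R : realType} (phi : R -> R) : Prop :=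
  phi x @[x --> +oo] --> (0 : R) /\ phi x @[x --> -oo] --> (0 : R).

(* Paths and homotopies are total functions on R and R * R, of which only the
   restrictions to [0, 1] and [0, 1] * [0, 1] matter. *)
Definition path_in {R : realType} {T : topologicalType} (A : set T) (x y : T)
    (g : R -> T) : Prop :=
  [/\ {within `[0, 1], continuous g},
      forall t : R, 0 <= t <= 1 -> A (g t),
      g 0 = x & g 1 = y].

Definition path_connected (R : realType) {T : topologicalType}
    (A : set T) : Prop :=
  A !=set0 /\ forall x y, A x -> A y -> exists g : R -> T, path_in A x y g.

(* Homotopy relative to the endpoints, from the loop g (at H (_, 0)) to the
   constant loop at x (at H (_, 1)). *)
Definition null_homotopic {R : realType} {T : topologicalType} (A : set T)
    (x : T) (g : R -> T) : Prop :=
  exists H : R * R -> T,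
    [/\ {within (`[0, 1]%classic `*` `[0, 1]%classic), continuous H},
        forall t s : R, 0 <= t <= 1 -> 0 <= s <= 1 -> A (H (t, s)),
        forall t : R, 0 <= t <= 1 -> H (t, 0) = g t,
        forall t : R, 0 <= t <= 1 -> H (t, 1) = x &
        forall s : R, 0 <= s <= 1 -> H (0, s) = x /\ H (1, s) = x].

Definition simply_connected (R : realType) {T : topologicalType}
    (A : set T) : Prop :=
  path_connected R A /\
  forall (x : T) (g : R -> T), A x -> path_in A x x g -> null_homotopic A x g.

(* Main.v *)
(** With [f = K * phi^2 >= 0], the equation [phi (2 c - phi) = 3 f] forces
    [0 <= phi <= 2 c], and [phi <= (3 / c) f] wherever [phi <= c], in particular
    near infinity.  For [0 < a < 1] the truncated weight
    [w x = exp (a min(|x|, n))] satisfies [w x <= exp (a |x - y|) w y], so the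
    supremum [M] of [w phi] satisfies [M <= D + M / 2] with [D] independent of
    [n]: on the tail [w phi^2 <= e M] with [e] small.  Letting [n] grow,
    [phi = O(exp (- a |x|))].  For [a = 3 / 4], [phi^2] is integrable against
    [exp |y|], whence [f], and then [phi], is [O(exp (- |x|))].
    The image is an interval by connectedness of [R], hence convex, and convex
    sets are simply connected. *)
Require Import Defs.
From mathcomp Require Import all_boot all_order all_algebra.
From mathcomp Require Import all_classical all_reals all_analysis.
From mathcomp Require Import measurable_realfun ring lra.
Import Order.TTheory GRing.Theory Num.Theory.
Import numFieldNormedType.Exports.

Set Implicit Arguments.
Unset Strict Implicit.

Local Open Scope classical_set_scope.
Local Open Scope ring_scope.

(** * Integrals of two-sided exponentials and domination by them *)

Lemma continuous_expRN_norm {R : realType} (b x : R) :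
  continuous (fun y : R => expR (- (b * `|x - y|))).
Proof.
move=> y; apply: continuous_comp; last exact: continuous_expR.
apply: cvgN; apply: cvgM; first exact: cvg_cst.
by apply: cvg_norm; apply: cvgB; [exact: cvg_cst | exact: cvg_id].
Qed.

(** The integrand is even, and on the half-line it is the exponential density of rate [b], of total
    mass 1, divided by [b]. *)
Lemma integral_expRN_norm0 {R : realType} (b : R) : 0 < b ->
  (\int[@lebesgue_measure R]_y (expR (- (b * `|y|)))%:E = (2 / b)%:E)%E.
Proof.
move=> b0.
rewrite (@ge0_symfun_integralT R (fun y => expR (- (b * `|y|)))).
- rewrite -set_itvcy.
  have E : (\int[@lebesgue_measure R]_(y in `[0%R, +oo[)
        (expR (- (b * `|y|)))%:E =
      b^-1%:E * \int[@lebesgue_measure R]_y (exponential_pdf b y)%:E)%E.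
    rewrite -ge0_integralZl//; last 3 first.
    - by apply/measurable_EFinP; exact: measurable_exponential_pdf.
    - by move=> y _; rewrite lee_fin exponential_pdf_ge0// ltW.
    - by rewrite lee_fin invr_ge0 ltW.
    rewrite [LHS]integral_mkcond; apply: eq_integral => y _.
    rewrite /exponential_pdf !patchE; case: ifPn => [|_]; last by rewrite mule0.
    rewrite inE/= in_itv/= andbT => y0.
    by rewrite -EFinM mulrA mulVf ?gt_eqF// mul1r ger0_norm// mulNr.
  by rewrite E integral_exponential_pdf// mule1 -EFinM.
- by move=> y; exact: expR_ge0.
- move=> y; have := @continuous_expRN_norm R b 0 y.
  by under eq_fun do rewrite sub0r normrN.
- by move=> y /=; rewrite normrN.
Qed.

Lemma integral_expRN_norm {R : realType} (b x : R) : 0 < b ->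
  (\int[@lebesgue_measure R]_y (expR (- (b * `|x - y|)))%:E = (2 / b)%:E)%E.
Proof.
move=> b0; rewrite -(@integral_expRN_norm0 R b)//.
have dF (y : R) : is_derive y 1 (fun z : R => z - x) 1.
  by rewrite -[X in is_derive _ _ _ X]subr0; exact: is_deriveB.
have F' : (fun z : R => z - x)^`()%classic = cst 1.
  by apply/funext => y; rewrite derive1E; exact: derive_val.
rewrite [RHS](@increasing_ge0_integration_by_substitutionT R (fun z => z - x)).
- apply: eq_integral => y _; rewrite F' /= !fctE/= mulr1.
  by rewrite distrC.
- by move=> u v uv; rewrite ltrD2r.
- by rewrite F'; exact: cst_continuous.
- by rewrite F'; exact: is_cvg_cst.
- by rewrite F'; exact: is_cvg_cst.
- by move=> y; exact: ex_derive.
- by apply/cvgrNyPle => A; near=> z; rewrite lerBlDr.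
- by apply/cvgryPge => A; near=> z; rewrite lerBrDr.
- move=> y; have := @continuous_expRN_norm R b 0 y.
  by under eq_fun do rewrite sub0r normrN.
- by move=> y; exact: expR_ge0.
Unshelve. all: by end_near. Qed.

(** Domination also makes [h] integrable, so the real integral is not a default value here and
    monotonicity applies. *)
Lemma Rintegral_le_expRN_norm {R : realType} (b C x : R) (h : R -> R) :
  0 < b -> continuous h ->
  (forall y, 0 <= h y <= C * expR (- (b * `|x - y|))) ->
  \int[@lebesgue_measure R]_(y in setT) h y <= C * (2 / b).
Proof.
move=> b0 ch hC.
have ig : (@lebesgue_measure R).-integrable setT
    (EFin \o (fun y => expR (- (b * `|x - y|)))).
  apply/integrableP; split.
    apply/measurable_EFinP; apply: continuous_measurable_fun.
    exact: continuous_expRN_norm.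
  under eq_integral do rewrite /= ger0_norm ?expR_ge0//.
  by rewrite integral_expRN_norm// ltry.
have iCg : (@lebesgue_measure R).-integrable setT
    (EFin \o (fun y => C * expR (- (b * `|x - y|)))).
  by have := integrableZl measurableT C ig; apply: eq_integrable.
have <- : \int[@lebesgue_measure R]_(y in setT) (C * expR (- (b * `|x - y|)))
    = C * (2 / b).
  by rewrite RintegralZl// /Rintegral integral_expRN_norm.
apply: le_Rintegral => //; last by move=> y _; have /andP[] := hC y.
apply: le_integrable iCg => //.
  by apply/measurable_EFinP; exact: continuous_measurable_fun.
move=> y _ /=; have /andP[h0 hle] := hC y.
by rewrite lee_fin ger0_norm// ger0_norm// (le_trans h0).
Qed.

Lemma continuous_convolution_K {R : realType} (g : R -> R) (x : R) :
  continuous g -> continuous (fun y => K (x - y) * g y).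
Proof.
move=> cg y; apply: cvgM; last exact: cg.
apply: cvgM; first exact: cvg_cst.
have := @continuous_expRN_norm R 1 x y.
by under eq_fun do rewrite mul1r.
Qed.

(** * Pointwise bounds and exponential decay of the solution *)

Section solution.
Variables (R : realType) (c : R) (phi : R -> R).

Local Notation f := (convolution K (fun y => phi y ^+ 2)).

Lemma convolution_K_sqr_ge0 x : 0 <= f x.
Proof.
apply: Rintegral_ge0 => y _.
by rewrite mulr_ge0 ?sqr_ge0// mulr_ge0 ?expR_ge0// invr_ge0.
Qed.

Lemma solution_bounds : 0 < c -> steady_DP c phi ->
  forall x, 0 <= phi x <= 2 * c.
Proof.
move=> c0 Ephi x.
have := convolution_K_sqr_ge0 x; rewrite -Ephi => h.
apply/andP; split.
(* Outside [[0, 2 c]] the factors [phi x] and [2 * c - phi x] have opposite signs, against [h]. *)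
- by have [//|p0] := leP 0 (phi x); nra.
- by have [//|p0] := leP (phi x) (2 * c); nra.
Qed.

Lemma continuous_sqr : continuous phi -> continuous (fun y => phi y ^+ 2).
Proof. by move=> cphi y; apply: cvgM; exact: cphi. Qed.

(** Where [phi x <= c], the factor [2 * c - phi x] is at least [c]. *)
Lemma solution_le_convolution : 0 < c -> steady_DP c phi ->
  forall x, phi x <= c -> phi x <= 3 / c * f x.
Proof.
move=> c0 Ephi x; have /andP[p0 _] := solution_bounds c0 Ephi x.
rewrite -Ephi => pc.
have -> : 3 / c * (phi x / 3 * (2 * c - phi x)) = phi x * (2 * c - phi x) / c.
  by field; rewrite gt_eqF.
by rewrite ler_pdivlMr//; nra.
Qed.

(** Serves both decay estimates: [r] is the weight at [x], and the centre [z] is [x] in the first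
    and [0] in the second. *)
Lemma weighted_convolution_le (b C r x z : R) :
  continuous phi -> 0 < b -> 0 < r ->
  (forall y, r * (K (x - y) * phi y ^+ 2) <= C * expR (- (b * `|z - y|))) ->
  r * f x <= C * (2 / b).
Proof.
move=> cphi b0 r0 h.
rewrite mulrC -ler_pdivlMr// mulrAC /convolution.
apply: (@Rintegral_le_expRN_norm R b _ z) => //.
  by apply: continuous_convolution_K; exact: continuous_sqr.
move=> y; apply/andP; split.
  by rewrite mulr_ge0 ?sqr_ge0// mulr_ge0 ?expR_ge0// invr_ge0.
by rewrite [leRHS]mulrAC ler_pdivlMr// mulrC.
Qed.

Lemma decays_tail (e : R) : decays phi -> 0 < e ->
  exists r : R, 0 <= r /\ forall x, r < `|x| -> phi x <= e.
Proof.
move=> dphi e0; case: dphi => /cvgrPdist_lt/(_ _ e0) [r1 [_ h1]].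
move=> /cvgrPdist_lt/(_ _ e0) [r2 [_ h2]].
(* The sign flips because the condition at minus infinity is [x < r2], that is [- r2 < - x]. *)
exists (Num.max 0 (Num.max r1 (- r2))).
split; first by rewrite le_max lexx.
move=> x; rewrite !gt_max => /and3P[x0 x1 x2].
suff : `|0 - phi x| < e.
  by rewrite sub0r normrN => /ltW; exact/le_trans/ler_norm.
have [xge|xlt] := leP 0 x.
- by apply: h1; move: x1; rewrite ger0_norm.
- by apply: h2; move: x2; rewrite ltr0_norm// ltrN2.
Qed.

Lemma solution_subexponential_decay (a : R) :
  0 < c -> continuous phi -> decays phi -> steady_DP c phi -> 0 < a < 1 ->
  exists D : R, forall x, expR (a * `|x|) * phi x <= D.
Proof.
move=> c0 cphi dphi Ephi /andP[a0 a1].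
have a1' : 0 < 1 - a by rewrite subr_gt0.
(* Chosen so that [3 / c * (e * M / (1 - a))] is exactly [M / 2]. *)
set e := c * (1 - a) / 6.
have e0 : 0 < e by rewrite /e divr_gt0// mulr_gt0.
have ec : e <= c by rewrite /e; nra.
have [r [r0 hr]] := decays_tail dphi e0.
set B := expR (a * r) * (2 * c).
have B0 : 0 <= B by rewrite mulr_ge0 ?expR_ge0// mulr_ge0// ltW.
set D := B + 3 / c * (B * (2 * c) / (1 - a)).
exists (D * 2) => x0.
pose w (x : R) := expR (a * Num.min `|x| `|x0|).
have w0 x : 0 < w x by exact: expR_gt0.
have wr x : `|x| <= r -> w x * phi x <= B.
  move=> xr; have /andP[p0 p1] := solution_bounds c0 Ephi x.
  apply: ler_pM => //; first exact: ltW.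
  by rewrite ler_expR ler_wpM2l ?(ltW a0)// ge_min xr.
have wxy x y : w x <= expR (a * `|x - y|) * w y.
  rewrite /w -expRD -mulrDr ler_expR ler_wpM2l ?(ltW a0)//.
  have h : `|x| <= `|x - y| + `|y|.
    by rewrite -{1}(subrK y x); exact: ler_normD.
  have := normr_ge0 (x - y).
  by rewrite /Num.min; case: ifP; case: ifP => *; lra.
set A := range (fun x => w x * phi x).
have ubA : has_ubound A.
  exists (expR (a * `|x0|) * (2 * c)) => _ [x _ <-].
  have /andP[p0 p1] := solution_bounds c0 Ephi x.
  apply: ler_pM => //; first exact: ltW.
  by rewrite ler_expR ler_wpM2l ?(ltW a0)// ge_min lexx orbT.
have A0 : A !=set0 by exists (w 0 * phi 0); exists 0.
set M := sup A.
have AM x : w x * phi x <= M by apply: ub_le_sup => //; exists x.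
have M0 : 0 <= M.
  apply: le_trans (AM 0); rewrite mulr_ge0 ?(ltW (w0 _))//.
  by have /andP[] := solution_bounds c0 Ephi 0.
(* The first term covers the ball of radius [r], where [w * phi] is at most [B]; the second covers
   the tail, where [phi] is at most [e]. *)
have wphi2 y : w y * phi y ^+ 2 <= B * (2 * c) + e * M.
  have /andP[p0 p1] := solution_bounds c0 Ephi y.
  have wp0 : 0 <= w y * phi y by rewrite mulr_ge0// ltW.
  rewrite expr2 mulrA; have [yr|yr] := leP `|y| r.
    rewrite -[leLHS]addr0 lerD//; last by rewrite mulr_ge0// ltW.
    by apply: ler_pM => //; exact: wr.
  rewrite -[leLHS]add0r lerD//; first by rewrite mulr_ge0// mulr_ge0// ltW.
  by rewrite mulrC; apply: ler_pM => //; exact: hr.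
(* Moving the weight from [x] to [y] costs [expR (a * |x - y|)], which the kernel absorbs, keeping
   the decay rate [1 - a]. *)
have key x : w x * f x <= 2^-1 * (B * (2 * c) + e * M) * (2 / (1 - a)).
  apply: (@weighted_convolution_le (1 - a) _ _ x x) => // y.
  have -> : - ((1 - a) * `|x - y|) = - `|x - y| + a * `|x - y| by ring.
  rewrite expRD /K.
  have := expR_ge0 (- `|x - y|); have := wxy x y; have := wphi2 y.
  have := sqr_ge0 (phi y); have := expR_ge0 (a * `|x - y|).
  set E := expR (a * _); set E' := expR (- _); set p := phi y ^+ 2.
  set Q := B * _ + _ => E0 p2 hQ hE E'0.
  have h1 : w x * p <= E * w y * p by rewrite ler_wpM2r.
  have h2 : E * (w y * p) <= E * Q by rewrite ler_wpM2l.
  have h3 : w x * p <= E * Q by apply: le_trans h1 _; rewrite -mulrA.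
  have h4 : E' * (w x * p) <= E' * (E * Q) by rewrite ler_wpM2l.
  by lra.
have step x : w x * phi x <= D + M / 2.
  have B'0 : 0 <= 3 / c * (B * (2 * c) / (1 - a)).
    by rewrite mulr_ge0 ?divr_ge0// ?mulr_ge0// ltW.
  have [xr|xr] := leP `|x| r.
    by have := wr x xr; rewrite /D; lra.
  have h := solution_le_convolution c0 Ephi (le_trans (hr x xr) ec).
  have h1 : w x * phi x <= 3 / c * (w x * f x).
    by rewrite mulrCA ler_wpM2l// ltW.
  have h2 := key x.
  have h3 : 3 / c * (w x * f x) <=
      3 / c * (2^-1 * (B * (2 * c) + e * M) * (2 / (1 - a))).
    by rewrite ler_wpM2l// divr_ge0// ltW.
  apply: le_trans h1 (le_trans h3 _); rewrite /D.
  have -> : 3 / c * (2^-1 * (B * (2 * c) + e * M) * (2 / (1 - a))) =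
      3 / c * (B * (2 * c) / (1 - a)) + M / 2.
    by rewrite /e; field; rewrite !gt_eqF.
  lra.
have MD : M <= D + M / 2 by apply: ge_sup => // _ [x _ <-]; exact: step.
(* As [M] is finite, [M / 2] can be absorbed on the left, giving [M <= D * 2]. *)
have := AM x0; rewrite /w minxx; lra.
Qed.

Lemma solution_exponential_decay :
  0 < c -> continuous phi -> decays phi -> steady_DP c phi ->
  exists C : R, forall x, expR `|x| * phi x <= C.
Proof.
move=> c0 cphi dphi Ephi.
(* Any rate above 1/2 would do: [phi ^+ 2] then decays faster than [expR (- |y|)]. With 3/4 the
   surplus rate is 1/2. *)
have h34 : 0 < (3 / 4 : R) < 1 by apply/andP; split; lra.
have [D hD] := solution_subexponential_decay c0 cphi dphi Ephi h34.
have key x : expR `|x| * f x <= 2^-1 * D ^+ 2 * (2 / 2^-1).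
  (* Since [|x| - |x - y| <= |y|], the weighted integrand has a bound independent of [x], hence the
     centre 0. *)
  apply: (@weighted_convolution_le 2^-1 _ _ x 0) => // y.
  rewrite sub0r normrN /K.
  set E := expR (3 / 4 * `|y|).
  have E0 : 0 < E by exact: expR_gt0.
  have /andP[p0 _] := solution_bounds c0 Ephi y.
  have h1 : (E * phi y) ^+ 2 <= D ^+ 2.
    by rewrite lerXn2r ?nnegrE ?(le_trans _ (hD y))// mulr_ge0// ltW.
  have h2 : expR `|x| * expR (- `|x - y|) <= E ^+ 2 * expR (- (2^-1 * `|y|)).
    rewrite expr2 /E -!expRD ler_expR.
    have : `|x| <= `|x - y| + `|y|.
      by rewrite -{1}(subrK y x); exact: ler_normD.
    lra.
  have h3 : expR `|x| * expR (- `|x - y|) * phi y ^+ 2 <=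
      E ^+ 2 * expR (- (2^-1 * `|y|)) * phi y ^+ 2.
    by rewrite ler_wpM2r ?sqr_ge0.
  have h4 : (E * phi y) ^+ 2 * expR (- (2^-1 * `|y|)) <=
      D ^+ 2 * expR (- (2^-1 * `|y|)).
    by rewrite ler_wpM2r ?expR_ge0.
  by rewrite exprMn in h4; lra.
(* Beyond [r] the solution is at most [c] and is controlled by [f]; within [r] the bound [2 * c]
   suffices. *)
have [r [r0 hr]] := decays_tail dphi c0.
set B := expR r * (2 * c); set Q := 2^-1 * D ^+ 2 * (2 / 2^-1) in key.
exists (B + 3 / c * Q) => x.
have B0 : 0 <= B by rewrite mulr_ge0 ?expR_ge0// mulr_ge0// ltW.
have c30 : 0 <= 3 / c by rewrite divr_ge0// ltW.
have Q0 : 0 <= 3 / c * Q.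
  rewrite mulr_ge0//; apply: le_trans (key 0).
  by rewrite mulr_ge0 ?expR_ge0// convolution_K_sqr_ge0.
have /andP[p0 p1] := solution_bounds c0 Ephi x.
have [xr|xr] := leP `|x| r.
  rewrite -[leLHS]addr0 lerD//.
  by apply: ler_pM; rewrite ?expR_ge0// ler_expR.
rewrite -[leLHS]add0r lerD//.
apply: le_trans (_ : 3 / c * (expR `|x| * f x) <= _); last by rewrite ler_wpM2l.
rewrite mulrCA ler_wpM2l ?expR_ge0//.
exact: solution_le_convolution (hr _ xr).
Qed.

End solution.

(** * Simple connectedness of intervals and the conclusion *)

Lemma interval_simply_connected {R : realType} (A : set R) :
  A !=set0 -> is_interval A -> simply_connected R A.
Proof.
move=> A0 itvA.
have convA (x y t : R) : A x -> A y -> 0 <= t <= 1 -> A ((1 - t) * x + t * y).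
  move=> Ax Ay /andP[t0 t1]; have [xy|yx] := leP x y.
    by apply: (itvA x y) => //; apply/andP; split; nra.
  by apply: (itvA y x) => //; apply/andP; split; nra.
split.
  split=> // x y Ax Ay; exists (fun t => (1 - t) * x + t * y); split.
  - apply: continuous_subspaceT => t; apply: cvgD; apply: cvgM.
    + by apply: cvgB; [exact: cvg_cst | exact: cvg_id].
    + exact: cvg_cst.
    + exact: cvg_id.
    + exact: cvg_cst.
  - by move=> t t01; exact: convA.
  - by rewrite subr0 mul1r mul0r addr0.
  - by rewrite subrr mul0r mul1r add0r.
move=> x g Ax [cg gA g0 g1].
(* Straight-line contraction to the base point; it fixes the endpoints because [g 0] and [g 1] both
   equal [x]. *)
exists (fun p => (1 - p.2) * g p.1 + p.2 * x); split.
- apply/subspace_continuousP => -[t s] [/= t01 s01].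
  (* The path is continuous only relative to the unit interval, so the first projection must
     converge in the restricted filter at [t]. *)
  have cf1 : (p.1 : R) @[p --> within (`[0, 1]%classic `*` `[0, 1]%classic)
      (nbhs (t, s))] --> within `[0, 1] (nbhs t).
    move=> U tU.
    have : nbhs (t, s) [set p : R * R | `[0, 1]%classic p.1 -> U p.1].
      exact: (@cvg_fst _ _ (nbhs t) (nbhs s) _ _ tU).
    apply: filterS => -[u v] /= Uu [u01 _]; exact: Uu.
  have cf2 : (p.2 : R) @[p --> within (`[0, 1]%classic `*` `[0, 1]%classic)
      (nbhs (t, s))] --> s.
    by apply: cvg_within_filter; exact: cvg_snd.
  have cgt : g (p.1 : R) @[p --> within (`[0, 1]%classic `*` `[0, 1]%classic)
      (nbhs (t, s))] --> g t.
    by move/subspace_continuousP : cg => /(_ t t01); exact: cvg_comp.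
  apply: cvgD; apply: cvgM => //; last exact: cvg_cst.
  by apply: cvgB => //; exact: cvg_cst.
- by move=> t s t01 s01; apply: convA => //; exact: gA.
- by move=> t t01 /=; rewrite subr0 mul1r mul0r addr0.
- by move=> t t01 /=; rewrite subrr mul0r mul1r add0r.
- by move=> s s01 /=; rewrite g0 g1; split; ring.
Qed.

Theorem theorem2p7 (R : realType) (c : R) (phi : R -> R) :
  0 < c ->
  continuous phi ->
  decays phi ->
  steady_DP c phi ->
  let S := range (fun x : R => expR `|x| * phi x) in
  [/\ bounded_set S, simply_connected R S & S `<=` `[0, +oo[ ].
Proof.
move=> c0 cphi dphi Ephi S.
have S0 x : 0 <= expR `|x| * phi x.
  rewrite mulr_ge0 ?expR_ge0//.
  by have /andP[] := solution_bounds c0 Ephi x.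
split.
- have [C hC] := solution_exponential_decay c0 cphi dphi Ephi.
  exists C; split; first exact: num_real.
  by move=> D CD _ [x _ <-] /=; rewrite ger0_norm// (le_trans (hC x)) ?ltW.
- apply: interval_simply_connected; first by eexists; exists 0.
  apply/connected_intervalP; apply: connected_continuous_connected.
    by apply/connected_intervalP => ? ? ? ? ?.
  apply: continuous_subspaceT => x; apply: cvgM; last exact: cphi.
  by apply: continuous_comp; [exact: norm_continuous | exact: continuous_expR].
- by move=> _ [x _ <-] /=; rewrite in_itv/= andbT.
Qed.
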